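(* Let $\Gamma=\{(t_i,\ell_i)\}_{i=1}^{L}$ be a discrete trajectory with $t_1<\dots<t_L$ and $\ell_i\in\mathbb{R}^2$, and let $\Delta S,\Delta T>0$. Run the SDS algorithm on $\Gamma$ with parameters $\Delta S,\Delta T$. (Precision.) For every continuous-model trajectory consistent with $\Gamma$, every record time $t_i$ labeled S by the algorithm lies in a continuous stay segment under $(\Delta S,\Delta T)$, and every record time $t_i$ labeled T lies in a continuous travel segment under $(\Delta S,\Delta T)$. (Recall.) Let the stay recall (respectively travel recall) be the fraction labeled S (respectively T) by the algorithm among those records of $\Gamma$ whose mobility can be inferred as stay (respectively travel) given $\Gamma$; assume in each case that at least one such record exists. Then $$\text{stay recall}\;\ge\;\frac{N_S(\Delta S/3)}{N_S(\Delta S)},\qquad \text{travel recall}\;\ge\;\frac{N_T(\Delta S)}{N_T(\Delta S/2)}.$$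
   Context: Conventions: a time period is a bounded closed interval of $\mathbb{R}$ (possibly a single point); $\|\cdot\|$ is the Euclidean norm. A continuous-model trajectory on a time period $T$ is a map $\ell:T\to\mathbb{R}^2$. Continuous mobility under parameters $(\Delta S,\Delta T)$: the segment of $\ell$ on a time period $\tau\subseteq T$ is a stay segment if $|\tau|\ge\Delta T$ and $\|\ell(t)-\ell(t')\|<\Delta S$ for all $t,t'\in\tau$; it is a travel segment if $\tau$ meets no time period of a stay segment. Dense stay segment under parameters $(s,\Delta T)$: a block of records $\{t_p,\dots,t_q\}$ of $\Gamma$, $1\le p<q\le L$, with $t_q-t_p\ge\Delta T$, $\|\ell_i-\ell_j\|<s$ for all $p\le i,j\le q$, and $t_{i+1}-t_i\le\Delta T$ for all $p\le i<q$. Continuous stay assumption under $(s,\Delta T)$: for every dense stay segment $\{t_p,\dots,t_q\}$ of $\Gamma$ under $(s,\Delta T)$, every $p\le i<q$ and every $t\in(t_i,t_{i+1})$, one has $\|\ell(t)-\ell(t_i)\|<s$ and $\|\ell(t)-\ell(t_{i+1})\|<s$. A continuous-model trajectory $\ell$ on a time period $T$ is consistent with $\Gamma$ if $T\supseteq\{t_1,\dots,t_L\}$, $\ell(t_i)=\ell_i$ for all $i$, and $\ell$ satisfies the continuous stay assumption under $(\Delta S/3,\Delta T)$ and under $(\Delta S,\Delta T)$. The mobility of record $t_i$ can be inferred as stay (travel) given $\Gamma$ if, for every consistent continuous-model trajectory on every such $T$, $t_i$ lies in a stay (travel) segment under $(\Delta S,\Delta T)$. SDS algorithm with stay threshold $a$,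 travel threshold $b$ and time parameter $\Delta T$. Step 1: cut $\Gamma$ at every consecutive interval larger than $\Delta T$, obtaining blocks; write a block as records $1,\dots,n$ with times $u_1<\dots<u_n$ and locations $x_1,\dots,x_n$. Then for each block: Step 2 (stay): set head $=1$; for cursor $=2,\dots,n$, go through anchor $=$ cursor$-1$ down to head; at the first anchor with $\|x_{\rm cursor}-x_{\rm anchor}\|\ge a$: if $u_{\rm cursor-1}-u_{\rm head}\ge\Delta T$, label all records head, $\dots$, cursor$-1$ as S; then set head $=$ anchor$+1$ and go to the next cursor. At the end, if $u_n-u_{\rm head}\ge\Delta T$, label records head, $\dots$, $n$ as S. Step 3 (travel): for each cursor in $2,\dots,n-1$ not labeled S, let left be the largest index $l<$ cursor with $\|x_{\rm cursor}-x_l\|\ge b$ and right the smallest index $r>$ cursor with $\|x_{\rm cursor}-x_r\|\ge b$; if both exist and $u_{\rm right}-u_{\rm left}\le\Delta T$, label the cursor record T. ''SDS with parameters $\Delta S,\Delta T$'' means $a=\Delta S/3$, $b=\Delta S$. $N_S(s)$ is the number of records labeled S when the stay threshold is $a=s$ (this does not depend on $b$), and $N_T(s)$ is the number of records labeled T when $b=s$ and $a=s/3$. *)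

(* Defs.v *)
From mathcomp Require Import all_boot all_order all_algebra.
From mathcomp Require Import boolp reals.

Set Implicit Arguments.
Unset Strict Implicit.
Unset Printing Implicit Defensive.

Import Order.TTheory GRing.Theory Num.Theory.

Local Open Scope ring_scope.

(* The Euclidean norm on the plane; the library norm on row vectors is the
   max norm. *)
Definition enorm (R : realType) (v : 'rV[R]_2) : R :=
  Num.sqrt (\sum_(k < 2) v 0 k ^+ 2).

Definition edist (R : realType) (x y : 'rV[R]_2) : R := enorm (x - y).

(* A discrete trajectory is a sequence of records (time, location).  Records,
   in a trajectory as in a block, are numbered from 0. *)
Definition rtime (R : realType) (G : seq (R * 'rV[R]_2)) (i : nat) : R :=
  (nth (0, 0) G i).1.

Definition rloc (R : realType) (G : seq (R * 'rV[R]_2)) (i : nat) : 'rV[R]_2 :=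
  (nth (0, 0) G i).2.

Definition discrete_trajectory (R : realType) (G : seq (R * 'rV[R]_2)) : bool :=
  sorted <%R [seq r.1 | r <- G].

(* A map from the time period [ct_lo, ct_hi] to the plane, extended
   arbitrarily outside the period: every definition below reads it only at
   times of the period.  No continuity is required. *)
Record ctraj (R : realType) := CTraj {
  ct_lo : R;
  ct_hi : R;
  ct_lo_le_hi : ct_lo <= ct_hi;
  ct_loc :> R -> 'rV[R]_2
}.

Definition subperiod (R : realType) (ell : ctraj R) (c d : R) : Prop :=
  [/\ ct_lo ell <= c, c <= d & d <= ct_hi ell].

Definition stay_segment (R : realType) (dS dT : R) (ell : ctraj R) (c d : R)
    : Prop :=
  [/\ subperiod ell c d, dT <= d - c
    & {in `[c, d] &, forall t t' : R, edist (ell t) (ell t') < dS}].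

Definition travel_segment (R : realType) (dS dT : R) (ell : ctraj R) (c d : R)
    : Prop :=
  subperiod ell c d /\
  forall c' d' : R, stay_segment dS dT ell c' d' ->
    {in `[c, d], forall t : R, t \notin `[c', d']}.

Definition in_stay_segment (R : realType) (dS dT : R) (ell : ctraj R) (t : R)
    : Prop :=
  exists c d : R, stay_segment dS dT ell c d /\ t \in `[c, d].

Definition in_travel_segment (R : realType) (dS dT : R) (ell : ctraj R) (t : R)
    : Prop :=
  exists c d : R, travel_segment dS dT ell c d /\ t \in `[c, d].

Definition dense_stay_segment (R : realType) (s dT : R)
    (G : seq (R * 'rV[R]_2)) (p q : nat) : Prop :=
  [/\ (p < q < size G)%N, dT <= rtime G q - rtime G p,
      forall i j : nat, (p <= i <= q)%N -> (p <= j <= q)%N ->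
        edist (rloc G i) (rloc G j) < s
    & forall i : nat, (p <= i < q)%N -> rtime G i.+1 - rtime G i <= dT].

Definition continuous_stay_assumption (R : realType) (s dT : R)
    (G : seq (R * 'rV[R]_2)) (ell : ctraj R) : Prop :=
  forall p q : nat, dense_stay_segment s dT G p q ->
  forall i : nat, (p <= i < q)%N ->
  {in `]rtime G i, rtime G i.+1[, forall t : R,
    edist (ell t) (ell (rtime G i)) < s /\
    edist (ell t) (ell (rtime G i.+1)) < s}.

Definition consistent (R : realType) (dS dT : R) (G : seq (R * 'rV[R]_2))
    (ell : ctraj R) : Prop :=
  [/\ forall i : nat, (i < size G)%N ->
        rtime G i \in `[ct_lo ell, ct_hi ell] /\ ell (rtime G i) = rloc G i,
      continuous_stay_assumption (dS / 3) dT G ell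
    & continuous_stay_assumption dS dT G ell].

Definition inferred_stay (R : realType) (dS dT : R) (G : seq (R * 'rV[R]_2))
    (i : nat) : Prop :=
  forall ell : ctraj R, consistent dS dT G ell ->
    in_stay_segment dS dT ell (rtime G i).

Definition inferred_travel (R : realType) (dS dT : R) (G : seq (R * 'rV[R]_2))
    (i : nat) : Prop :=
  forall ell : ctraj R, consistent dS dT G ell ->
    in_travel_segment dS dT ell (rtime G i).

(* Step 1 of SDS.  The blocks are never empty, so head r B is the record that
   follows r. *)
Fixpoint cut_blocks (R : realType) (dT : R) (G : seq (R * 'rV[R]_2))
    : seq (seq (R * 'rV[R]_2)) :=
  if G is r :: G' then
    if cut_blocks dT G' is B :: Bs then
      if dT < (head r B).1 - r.1 then [:: r] :: B :: Bs else (r :: B) :: Bs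
    else [:: [:: r]]
  else [::].

Definition far (R : realType) (d : R) (B : seq (R * 'rV[R]_2)) (i : nat)
    : pred nat :=
  fun j => d <= edist (rloc B i) (rloc B j).

(* Step 2 of SDS: the state carries the head and the indices labeled S so far;
   rev (iota head (cursor - head)) lists the anchors from cursor - 1 down to
   head. *)
Definition stay_step (R : realType) (a dT : R) (B : seq (R * 'rV[R]_2))
    (st : nat * seq nat) (cursor : nat) : nat * seq nat :=
  let: (hd, lab) := st in
  if ohead (filter (far a B cursor) (rev (iota hd (cursor - hd))))
    is Some anchor then
    (anchor.+1,
     if dT <= rtime B cursor.-1 - rtime B hd
     then lab ++ iota hd (cursor - hd) else lab)
  else st.

Definition block_stay (R : realType) (a dT : R) (B : seq (R * 'rV[R]_2))
    : seq nat :=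
  let n := size B in
  let: (hd, lab) := foldl (stay_step a dT B) (0%N, [::]) (iota 1 n.-1) in
  if dT <= rtime B n.-1 - rtime B hd then lab ++ iota hd (n - hd) else lab.

(* Step 3 of SDS, for the record of index cursor in the block B. *)
Definition block_travel (R : realType) (a b dT : R) (B : seq (R * 'rV[R]_2))
    (cursor : nat) : bool :=
  let n := size B in
  [&& (0 < cursor < n.-1)%N, cursor \notin block_stay a dT B
    & match ohead (filter (far b B cursor) (rev (iota 0 cursor))),
            ohead (filter (far b B cursor) (iota cursor.+1 (n - cursor.+1)))
      with
      | Some l, Some r => rtime B r - rtime B l <= dT
      | _, _ => false
      end].

(* The labels S and T given by SDS to the records of G, in the order of G
   (the blocks are consecutive, so their labels are concatenated). *)
Definition sds_stay (R : realType) (a dT : R) (G : seq (R * 'rV[R]_2))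
    : bitseq :=
  flatten [seq mkseq (fun j => j \in block_stay a dT B) (size B)
          | B <- cut_blocks dT G].

Definition sds_travel (R : realType) (a b dT : R) (G : seq (R * 'rV[R]_2))
    : bitseq :=
  flatten [seq mkseq (block_travel a b dT B) (size B) | B <- cut_blocks dT G].

(* SDS with parameters dS, dT has stay threshold dS / 3 and travel threshold
   dS. *)
Definition labeled_stay (R : realType) (dS dT : R) (G : seq (R * 'rV[R]_2))
    (i : nat) : bool :=
  nth false (sds_stay (dS / 3) dT G) i.

Definition labeled_travel (R : realType) (dS dT : R) (G : seq (R * 'rV[R]_2))
    (i : nat) : bool :=
  nth false (sds_travel (dS / 3) dS dT G) i.

Definition NS (R : realType) (dT : R) (G : seq (R * 'rV[R]_2)) (s : R) : nat :=
  count id (sds_stay s dT G).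

Definition NT (R : realType) (dT : R) (G : seq (R * 'rV[R]_2)) (s : R) : nat :=
  count id (sds_travel (s / 3) s dT G).

Definition fraction_labeled (R : realType) (n : nat) (lab : nat -> bool)
    (P : nat -> Prop) : R :=
  #|[set i : 'I_n | `[< P i >] && lab i]|%:R / #|[set i : 'I_n | `[< P i >]]|%:R.

Definition stay_recall (R : realType) (dS dT : R) (G : seq (R * 'rV[R]_2)) : R :=
  fraction_labeled R (size G) (labeled_stay dS dT G) (inferred_stay dS dT G).

Definition travel_recall (R : realType) (dS dT : R) (G : seq (R * 'rV[R]_2))
    : R :=
  fraction_labeled R (size G) (labeled_travel dS dT G)
    (inferred_travel dS dT G).

(* Main.v *)
Require Import Defs.
From mathcomp Require Import all_boot all_order all_algebra.
From mathcomp Require Import boolp reals.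
From mathcomp Require Import lra zify.

Import Order.TTheory GRing.Theory Num.Theory.

Local Open Scope ring_scope.

(** A record is labeled S with threshold [a] exactly when it lies in a dense
stay segment under [a], since the head always starts the longest window of
pairwise distances below [a] that ends at the cursor.  So a record inferred as
stay is labeled S with threshold [dS]: otherwise the gaps on both sides of it
are unconstrained, and a consistent trajectory can jump to a point at distance
[dS] immediately before and after the record.  A record [c] inferred as travel
is labeled T with thresholds [dS / 6] and [dS / 2]: otherwise the records
around [c] stay within [dS / 2] of it during an open period longer than [dT],
and the trajectory that in every gap holds the location of the record nearer
to [c] is consistent and has a stay segment through [c].  The recall bounds
follow from these two inclusions and from precision by counting. *)

(** * The Euclidean distance on the plane *)

Lemma enormE {R : realType} (v : 'rV[R]_2) :
  enorm v = Num.sqrt (v 0 0 ^+ 2 + v 0 1 ^+ 2).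
Proof.
by rewrite /enorm !big_ord_recl big_ord0 addr0; congr (Num.sqrt (_ + v 0 _ ^+ 2)); apply: val_inj.
Qed.

Lemma enormN {R : realType} (v : 'rV[R]_2) : enorm (- v) = enorm v.
Proof. by rewrite !enormE !mxE !sqrrN. Qed.

Lemma enormD {R : realType} (v w : 'rV[R]_2) : enorm (v + w) <= enorm v + enorm w.
Proof.
rewrite !enormE !mxE.
set a := v 0 0; set b := v 0 1; set c := w 0 0; set d := w 0 1.
have hv : Num.sqrt (a ^+ 2 + b ^+ 2) ^+ 2 = a ^+ 2 + b ^+ 2.
  by rewrite sqr_sqrtr // addr_ge0 ?sqr_ge0.
have hw : Num.sqrt (c ^+ 2 + d ^+ 2) ^+ 2 = c ^+ 2 + d ^+ 2.
  by rewrite sqr_sqrtr // addr_ge0 ?sqr_ge0.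
move: hv hw (sqrtr_ge0 (a ^+ 2 + b ^+ 2)) (sqrtr_ge0 (c ^+ 2 + d ^+ 2)).
set x := Num.sqrt (a ^+ 2 + _); set y := Num.sqrt (c ^+ 2 + _) => hv hw x0 y0.
have cs : a * c + b * d <= x * y.
  (* Cauchy-Schwarz by squaring, through Lagrange's identity: the difference of the squares is
     [(a * d - b * c) ^+ 2]. *)
  rewrite (le_trans (ler_norm _)) // -(ler_pXn2r (ltn0Sn 1)) ?nnegrE ?mulr_ge0 //.
  rewrite real_normK ?num_real // exprMn hv hw -subr_ge0.
  rewrite (_ : _ - _ = (a * d - b * c) ^+ 2) ?sqr_ge0 //; lra.
rewrite -(ger0_norm (addr_ge0 x0 y0)) -sqrtr_sqr ler_wsqrtr //.
move: cs hv hw; rewrite !expr2; nra.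
Qed.

Lemma edistxx {R : realType} (x : 'rV[R]_2) : edist x x = 0.
Proof. by rewrite /edist subrr enormE !mxE expr0n addr0 sqrtr0. Qed.

Lemma edistC {R : realType} (x y : 'rV[R]_2) : edist x y = edist y x.
Proof. by rewrite /edist -enormN opprB. Qed.

Lemma edist_triangle {R : realType} (y x z : 'rV[R]_2) :
  edist x z <= edist x y + edist y z.
Proof. by rewrite /edist -[x - z](subrKA y) enormD. Qed.

Lemma exists_edist_eq {R : realType} (x : 'rV[R]_2) (d : R) :
  0 <= d -> exists y : 'rV[R]_2, edist x y = d.
Proof.
move=> d0; exists (x + d *: delta_mx 0 0).
by rewrite /edist opprD addNKr enormN enormE !mxE /= mulr1 mulr0 expr0n addr0 sqrtr_sqr ger0_norm.
Qed.

(** * Order of record times, and searches through ranges of indices *)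

Lemma rtime_ltE {R : realType} (G : seq (R * 'rV[R]_2)) (i j : nat) :
  discrete_trajectory G -> (i < size G)%N -> (j < size G)%N ->
  (rtime G i < rtime G j) = (i < j)%N.
Proof.
move=> sG hi hj.
have nthE k : (k < size G)%N -> rtime G k = nth 0 [seq r.1 | r <- G] k.
  by move=> hk; rewrite (nth_map (0, 0)).
by rewrite !nthE // (lt_sorted_ltn_nth 0 sG) // inE size_map.
Qed.

Lemma rtime_leE {R : realType} (G : seq (R * 'rV[R]_2)) (i j : nat) :
  discrete_trajectory G -> (i < size G)%N -> (j < size G)%N ->
  (rtime G i <= rtime G j) = (i <= j)%N.
Proof. by move=> sG hi hj; rewrite leNgt rtime_ltE // -leqNgt. Qed.

(** Filtering preserves the increasing order, so the first index kept is the least one. This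
    describes the right search of the travel step; the reversed version below serves the anchor and
    left searches. *)
Lemma ohead_filter_iota (P : pred nat) (m n : nat) :
  if ohead (filter P (iota m n)) is Some k then
    [/\ (m <= k < m + n)%N, P k & forall j, (m <= j < k)%N -> ~~ P j]
  else forall j, (m <= j < m + n)%N -> ~~ P j.
Proof.
case e: (filter P (iota m n)) => [|k s] /=.
  move=> j hj; apply/negP => Pj.
  by have := mem_filter P j (iota m n); rewrite e Pj mem_iota hj.
have: k \in filter P (iota m n) by rewrite e mem_head.
rewrite mem_filter mem_iota => /andP[Pk hk]; split=> // j /andP[mj jk].
apply/negP => Pj.
have: j \in filter P (iota m n).
  by rewrite mem_filter Pj mem_iota mj (ltn_trans jk) //; case/andP: hk.
have := sorted_filter ltn_trans P (iota_ltn_sorted m n).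
rewrite e inE /= => /(order_path_min ltn_trans)/allP h /orP[/eqP jE|/h].
  by rewrite jE ltnn in jk.
by rewrite ltnNge (ltnW jk).
Qed.

Lemma ohead_filter_rev_iota (P : pred nat) (m n : nat) :
  if ohead (filter P (rev (iota m n))) is Some k then
    [/\ (m <= k < m + n)%N, P k & forall j, (k < j < m + n)%N -> ~~ P j]
  else forall j, (m <= j < m + n)%N -> ~~ P j.
Proof.
case e: (filter P _) => [|k s] /=.
  move=> j hj; apply/negP => Pj.
  by have := mem_filter P j (rev (iota m n)); rewrite e Pj mem_rev mem_iota hj.
have: k \in filter P (rev (iota m n)) by rewrite e mem_head.
rewrite mem_filter mem_rev mem_iota => /andP[Pk hk]; split=> // j /andP[kj jn].
apply/negP => Pj.
have: j \in filter P (rev (iota m n)).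
  rewrite mem_filter Pj mem_rev mem_iota jn andbT (leq_trans _ (ltnW kj)) //.
  by case/andP: hk.
have := sorted_filter (rev_trans ltn_trans) P.
move/(_ (rev (iota m n))); rewrite rev_sorted => /(_ (iota_ltn_sorted m n)).
rewrite e inE /= => /(order_path_min (rev_trans ltn_trans))/allP h /orP[/eqP jE|/h].
  by rewrite jE ltnn in kj.
by rewrite /= ltnNge (ltnW kj).
Qed.

(** * The stay step inside one block *)

(** A dense stay segment without its gap condition, which holds automatically inside a block. *)
Definition long_window {R : realType} (a dT : R) (B : seq (R * 'rV[R]_2))
    (p q : nat) : Prop :=
  (forall i j : nat, (p <= i <= q)%N -> (p <= j <= q)%N ->
     edist (rloc B i) (rloc B j) < a) /\
  dT <= rtime B q - rtime B p.

(** The loop invariant once cursor [c] is processed. The last two clauses are soundness and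
    completeness of the labels: a long window not yet fully labeled must start at or after the head,
    so a later step can still label it. *)
Definition stay_invariant {R : realType} (a dT : R) (B : seq (R * 'rV[R]_2))
    (c : nat) (st : nat * seq nat) : Prop :=
  [/\ (st.1 <= c)%N,
      forall i j : nat, (st.1 <= i <= c)%N -> (st.1 <= j <= c)%N ->
        edist (rloc B i) (rloc B j) < a,
      forall j : nat, j \in st.2 ->
        exists p q : nat, (p <= j <= q)%N /\ (q <= c)%N /\ long_window a dT B p q
    & forall p q : nat, (p <= q)%N -> long_window a dT B p q ->
        (st.1 <= p)%N \/ forall j : nat, (p <= j <= q)%N -> j \in st.2].

Lemma stay_step_invariant {R : realType} (a dT : R) (B : seq (R * 'rV[R]_2))
    (c : nat) (st : nat * seq nat) :
  0 < a ->
  (forall i j : nat, (i <= j < size B)%N -> rtime B i <= rtime B j) ->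
  (c.+1 < size B)%N -> stay_invariant a dT B c st ->
  stay_invariant a dT B c.+1 (stay_step a dT B st c.+1).
Proof.
move=> a0 mono hc; case: st => hd lab [/= hdc close sound compl].
rewrite /stay_step.
have := ohead_filter_rev_iota (far a B c.+1) hd (c.+1 - hd).
have hE : (hd + (c.+1 - hd) = c.+1)%N by lia.
have close_step h : (hd <= h <= c.+1)%N ->
    (forall j, (h <= j <= c)%N -> edist (rloc B c.+1) (rloc B j) < a) ->
    forall i j, (h <= i <= c.+1)%N -> (h <= j <= c.+1)%N ->
      edist (rloc B i) (rloc B j) < a.
  move=> hh near i j hi hj.
  have [->|ni] := eqVneq i c.+1; have [->|nj] := eqVneq j c.+1.
  - by rewrite edistxx.
  - by apply: near; lia.
  - by rewrite edistC; apply: near; lia.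
  - by apply: close; lia.
rewrite hE; case: ohead => [k [hk fark nfar]|nfar].
- split=> /=.
  + lia.
  + apply: close_step => [|j hj]; first lia.
    by rewrite ltNge; apply: nfar; lia.
  + move=> j; case: ifP => [dTle|_].
      rewrite mem_cat mem_iota hE => /orP[/sound[p [q [h1 [h2 h3]]]]|hj].
        by exists p, q; split=> //; split=> //; lia.
      by exists hd, c; split; [lia|split; [lia|split]].
    by move/sound => [p [q [h1 [h2 h3]]]]; exists p, q; split=> //; split=> //; lia.
  (* A window starting at or before the anchor [k] cannot reach [c.+1], which is far from [k]. So it
     ends by [c]; if it starts at or after the old head, it makes the range from [hd] to [c] long
     enough to be labeled now. *)
  + move=> p q hpq win; have [kp|pk] := ltnP k p; [by left|right].
    have qc : (q <= c)%N.
      rewrite leqNgt; apply/negP => cq; have [h _] := win.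
      have := h c.+1 k; rewrite ltNge (fark : a <= _) => hf; have: false by apply: hf; lia.
      by [].
    case: (compl p q hpq win) => [hdp|inlab j hj].
      have -> : dT <= rtime B c - rtime B hd.
        have m1 : rtime B hd <= rtime B p by apply: mono; lia.
        have m2 : rtime B q <= rtime B c by apply: mono; lia.
        have := win.2; lra.
      by move=> j hj; rewrite mem_cat mem_iota; apply/orP; right; lia.
    by case: ifP => _; rewrite ?mem_cat inlab.
- split=> /=.
  + lia.
  + apply: close_step => [|j hj]; first lia.
    by rewrite ltNge; apply: nfar; lia.
  + by move=> j /sound [p [q [h1 [h2 h3]]]]; exists p, q; split=> //; split=> //; lia.
  + exact: compl.
Qed.

Lemma stay_foldl_invariant {R : realType} (a dT : R) (B : seq (R * 'rV[R]_2))
    (m c : nat) (st : nat * seq nat) :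
  0 < a ->
  (forall i j : nat, (i <= j < size B)%N -> rtime B i <= rtime B j) ->
  (c + m < size B)%N -> stay_invariant a dT B c st ->
  stay_invariant a dT B (c + m) (foldl (stay_step a dT B) st (iota c.+1 m)).
Proof.
move=> a0 mono; elim: m c st => [|m IH] c st hc inv; first by rewrite addn0.
rewrite addnS -addSn /=; apply: IH; first by lia.
by apply: stay_step_invariant => //; lia.
Qed.

(** After the last cursor, every long window still unlabeled lies between the head and the end of
    the block, so the final test of the algorithm labels it. *)
Lemma mem_block_stay {R : realType} (a dT : R) (B : seq (R * 'rV[R]_2))
    (j : nat) :
  0 < a ->
  (forall i j : nat, (i <= j < size B)%N -> rtime B i <= rtime B j) ->
  (j < size B)%N ->
  j \in block_stay a dT B <->
  exists p q : nat, (p <= j <= q)%N /\ (q < size B)%N /\ long_window a dT B p q.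
Proof.
move=> a0 mono hj; rewrite /block_stay.
have inv0 : stay_invariant a dT B 0 (0%N, [::]).
  split=> //= [i k|p q _ _]; last by left.
  by rewrite !leqn0 => /eqP-> /eqP->; rewrite edistxx.
have := @stay_foldl_invariant R a dT B (size B).-1 0 _ a0 mono ltac:(lia) inv0.
rewrite add0n; case: foldl => hd lab [/= hdn close sound compl].
have hE : (hd + (size B - hd) = size B)%N by lia.
split.
- have : j \in lab -> exists p q, (p <= j <= q)%N /\ (q < size B)%N /\
      long_window a dT B p q.
    by move/sound => [p [q [h1 [h2 h3]]]]; exists p, q; split=> //; split=> //; lia.
  case: ifP => [dTle|_ //] inl; rewrite mem_cat mem_iota hE => /orP[/inl //|hjj].
  by exists hd, (size B).-1; split; [lia|split; [lia|split]].
- move=> [p [q [hpj [qn win]]]].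
  have [hdp|inlab] := compl p q ltac:(lia) win.
    have -> : dT <= rtime B (size B).-1 - rtime B hd.
      have m1 : rtime B hd <= rtime B p by apply: mono; lia.
      have m2 : rtime B q <= rtime B (size B).-1 by apply: mono; lia.
      have := win.2; lra.
    by rewrite mem_cat mem_iota; apply/orP; right; lia.
  by case: ifP => _; rewrite ?mem_cat inlab.
Qed.

(** * Blocks as index ranges of the whole trajectory *)

(** The block is located by its offset [o], so that indices translate by adding [o]. The last two
    clauses say that it is maximal: the gaps next to it, where they exist, are cuts. *)
Definition is_block {R : realType} (dT : R) (G : seq (R * 'rV[R]_2)) (o : nat)
    (B : seq (R * 'rV[R]_2)) : Prop :=
  [/\ (o + size B <= size G)%N,
      forall j : nat, (j < size B)%N -> nth (0, 0) B j = nth (0, 0) G (o + j),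
      forall k : nat, (k.+1 < size B)%N ->
        rtime G (o + k).+1 - rtime G (o + k) <= dT,
      (0 < o)%N -> dT < rtime G o - rtime G o.-1
    & (o + size B < size G)%N ->
        dT < rtime G (o + size B) - rtime G (o + size B).-1].

Lemma cut_blocksP {R : realType} (dT : R) (G : seq (R * 'rV[R]_2)) :
  let Bs := cut_blocks dT G in
  [/\ flatten Bs = G, all (fun B => B != [::]) Bs,
      all (sorted (fun r r' => r'.1 - r.1 <= dT)) Bs
    & sorted (fun B B' => dT < (head (0, 0) B').1 - (last (0, 0) B).1) Bs].
Proof.
elim: G => [//|r G]; rewrite /=.
case: cut_blocks => [|B Bs] /=; first by case=> <-.
case=> <- /andP[B0 all0] /andP[sB alls] pBs.
case: B B0 sB pBs => [//|b B] _ /= sB pBs.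
case: ifP => hgap /=; first by rewrite all0 alls sB hgap pBs.
rewrite all0 alls sB leNgt hgap; split=> //.
by case: Bs pBs {all0 alls}.
Qed.

(** The labeling [f] is quantified after the block is chosen, so that the same statement serves the
    labels S and T. *)
Lemma nth_flatten_split {T : Type} (Bs : seq (seq T)) (i : nat) :
  (i < size (flatten Bs))%N ->
  exists Bs1 B Bs2, [/\ Bs = Bs1 ++ B :: Bs2,
    (size (flatten Bs1) <= i < size (flatten Bs1) + size B)%N
    & forall f : seq T -> nat -> bool,
      nth false (flatten [seq mkseq (f B) (size B) | B <- Bs]) i
        = f B (i - size (flatten Bs1))%N].
Proof.
elim: Bs i => [//|B Bs IH] i; rewrite /= size_cat => hi.
have [iB|Bi] := ltnP i (size B).
  exists [::], B, Bs; split=> //= f.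
  by rewrite nth_cat size_mkseq iB nth_mkseq // subn0.
have [|Bs1 [B' [Bs2 [-> h1 h2]]]] := IH (i - size B)%N; first by lia.
exists (B :: Bs1), B', Bs2; split=> //= [|f]; first by rewrite size_cat; lia.
by rewrite nth_cat size_mkseq ltnNge Bi /= h2 size_cat subnDA.
Qed.

Lemma cut_blocks_nth {R : realType} (dT : R) (G : seq (R * 'rV[R]_2)) (i : nat) :
  (i < size G)%N ->
  exists o B, [/\ is_block dT G o B, (o <= i < o + size B)%N
    & forall f : seq (R * 'rV[R]_2) -> nat -> bool,
      nth false (flatten [seq mkseq (f B) (size B) | B <- cut_blocks dT G]) i
        = f B (i - o)%N].
Proof.
move=> hi; have [flatE all0 alls gaps] := cut_blocksP dT G.
have /nth_flatten_split [Bs1 [B [Bs2 [BsE hB nthE]]]] :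
  (i < size (flatten (cut_blocks dT G)))%N by rewrite flatE.
exists (size (flatten Bs1)), B; split=> //.
move: flatE all0 alls gaps; rewrite BsE flatten_cat /= !all_cat /=.
move=> GE /and3P[all1 B0 all2] /and3P[_ sB _] gaps.
(* Blocks are nonempty, so the record just before [B] is the last record of the preceding block;
   [gapr] is the symmetric fact. *)
have gapl : flatten Bs1 != [::] ->
    dT < (head (0, 0) B).1 - (last (0, 0) (flatten Bs1)).1.
  case/lastP: Bs1 all1 gaps {hB nthE BsE GE} => [//|Bs1 B'].
  rewrite all_rcons cat_rcons => /andP[B'0 _] /cat_sorted2[_] /= /andP[+ _] _.
  by rewrite flatten_rcons last_cat; case: B' B'0.
have gapr : flatten Bs2 != [::] ->
    dT < (head (0, 0) (flatten Bs2)).1 - (last (0, 0) B).1.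
  case: Bs2 all2 gaps {BsE GE} => [//|[//|b' B'] Bs2] _.
  by move=> /cat_sorted2[_] /= /andP[].
move: gapl gapr GE; set s := flatten Bs1; set t := flatten Bs2.
move=> gapl gapr <-; rewrite /is_block /rtime !size_cat.
have nB : (0 < size B)%N by case: (B) B0.
have nthB j : (j < size B)%N ->
    nth (0, 0) (s ++ B ++ t) (size s + j) = nth (0, 0) B j.
  by move=> hj; rewrite nth_cat ltnNge leq_addr /= addKn nth_cat hj.
split.
- by rewrite addnA leq_addr.
- by move=> j /nthB.
- move=> k hk; rewrite -addnS !nthB //; last by apply: ltnW.
  by have /sortedP := sB; apply.
- move=> s0; have := gapl ltac:(by case: (s) s0).
  rewrite -[in nth _ _ (size s)](addn0 (size s)) nthB // nth0.
  by rewrite nth_cat ltn_predL s0 nth_last.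
- rewrite addnA -[ltnLHS]addn0 ltn_add2l => t0; have := gapr ltac:(by case: (t) t0).
  have -> : (size s + size B).-1 = (size s + (size B).-1)%N by lia.
  rewrite (nthB (size B).-1) ?ltn_predL // nth_last.
  by rewrite catA nth_cat size_cat ltnn subnn nth0.
Qed.

(** A dense stay segment cannot cross a cut, since its gaps are at most [dT]; hence it lies within
    one block. Conversely a long window has [p < q] because [dT] is positive. *)
Lemma mem_block_stayE {R : realType} (a dT : R) (G B : seq (R * 'rV[R]_2))
    (o i : nat) :
  discrete_trajectory G -> 0 < a -> 0 < dT -> is_block dT G o B ->
  (o <= i < o + size B)%N ->
  (i - o)%N \in block_stay a dT B <->
  exists p q : nat, (p <= i <= q)%N /\ dense_stay_segment a dT G p q.
Proof.
move=> sG a0 dT0 [szB nthB gapB gapl gapr] hi.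
have rtB j : (j < size B)%N -> rtime B j = rtime G (o + j).
  by move=> hj; rewrite /rtime nthB.
have rlB j : (j < size B)%N -> rloc B j = rloc G (o + j).
  by move=> hj; rewrite /rloc nthB.
have mono k l : (k <= l < size B)%N -> rtime B k <= rtime B l.
  by move=> hkl; rewrite !rtB ?rtime_leE //; lia.
rewrite (mem_block_stay _ _ _ _ a0 mono); last by lia.
split=> [[p [q [hpq [qB [close long]]]]]|[p [q [hpq [hq long close gap]]]]].
- exists (o + p)%N, (o + q)%N; split; first by lia.
  move: long; rewrite !rtB; try lia; move=> long.
  split=> //.
  + have : rtime G (o + p) < rtime G (o + q) by lra.
    by rewrite rtime_ltE //; lia.
  + move=> k l hk hl; have := close (k - o)%N (l - o)%N ltac:(lia) ltac:(lia).
    by rewrite !rlB ?subnKC //; lia.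
  + move=> k hk; have := gapB (k - o)%N ltac:(lia).
    by rewrite subnKC //; lia.
- have op : (o <= p)%N.
    rewrite leqNgt; apply/negP => po.
    have := gap o.-1 ltac:(lia); have := gapl ltac:(lia).
    by rewrite prednK; [lra|lia].
  have qo : (q < o + size B)%N.
    rewrite ltnNge; apply/negP => qo.
    have := gap (o + size B).-1 ltac:(lia); have := gapr ltac:(lia).
    by rewrite prednK; [lra|lia].
  exists (p - o)%N, (q - o)%N; split; first by lia.
  split; first by lia.
  split.
  + move=> k l hk hl; rewrite !rlB; try lia.
    by apply: close; lia.
  + by rewrite !rtB ?subnKC //; lia.
Qed.

(** * Step functions centered at a record *)

(* Step functions reading the record [step_index G c t] at time [t] hold their
   value towards the record [c]: up to the next record before the time of [c],
   from the previous record after it. *)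
Definition step_index {R : realType} (G : seq (R * 'rV[R]_2)) (c : nat) (t : R)
    : nat :=
  if t < rtime G c then find (fun r => t <= r.1) G
  else (find (fun r => t < r.1) G).-1.

Lemma step_indexP {R : realType} (G : seq (R * 'rV[R]_2)) (c : nat) (t : R) :
  discrete_trajectory G -> (c < size G)%N ->
  (step_index G c t < size G)%N /\
  if t < rtime G c then
    (step_index G c t <= c)%N /\
    forall k : nat, (k < size G)%N ->
      (t <= rtime G k) = (step_index G c t <= k)%N
  else
    (c <= step_index G c t)%N /\
    forall k : nat, (k < size G)%N ->
      (rtime G k <= t) = (k <= step_index G c t)%N.
Proof.
move=> sG hc; rewrite /step_index.
(* For a predicate that stays true along the records once it holds, [find] returns the threshold
   index. *)
have findE (P : pred (R * 'rV[R]_2)) k : (k < size G)%N ->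
    (forall i j, (i <= j < size G)%N ->
      P (nth (0, 0) G i) -> P (nth (0, 0) G j)) ->
    P (nth (0, 0) G k) = (find P G <= k)%N.
  move=> hk up; apply/idP/idP => [Pk|fk].
    by rewrite leqNgt; apply/negP => /(before_find (0, 0)); rewrite Pk.
  apply: (up (find P G)); first by rewrite fk.
  by apply: nth_find; rewrite has_find (leq_ltn_trans fk).
have mono i j : (i <= j < size G)%N -> rtime G i <= rtime G j.
  by move=> hij; rewrite rtime_leE //; lia.
case: ifPn => ht.
  have E k : (k < size G)%N ->
      (t <= rtime G k) = (find (fun r => (t <= r.1)%R) G <= k)%N.
    move=> hk; apply: (findE (fun r => t <= r.1)) => // i j hij /le_trans; apply.
    exact: mono.
  have mc : (find (fun r => (t <= r.1)%R) G <= c)%N by rewrite -E // ltW.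
  by split; [apply: leq_ltn_trans mc hc|split].
have E k : (k < size G)%N ->
    (t < rtime G k) = (find (fun r => (t < r.1)%R) G <= k)%N.
  move=> hk; apply: (findE (fun r => t < r.1)) => // i j hij /lt_le_trans; apply.
  exact: mono.
(* Record [c] fails the test, so [find] is positive and its predecessor is the last record not after
   [t], also when [find] returns [size G]. *)
have mc : (c < find (fun r => (t < r.1)%R) G)%N by rewrite ltnNge -E.
have fs : (find (fun r => (t < r.1)%R) G <= size G)%N by apply: find_size.
split; first by lia.
split; first by lia.
by move=> k hk; rewrite leNgt E //; lia.
Qed.

Lemma step_index_rtime {R : realType} (G : seq (R * 'rV[R]_2)) (c k : nat) :
  discrete_trajectory G -> (c < size G)%N -> (k < size G)%N ->
  step_index G c (rtime G k) = k.
Proof.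
move=> sG hc hk; have [hm] := step_indexP G c (rtime G k) sG hc.
case: ifP => _ [_ mE]; apply/eqP; rewrite eqn_leq.
  by rewrite -mE // lexx /= -(rtime_leE G) // mE.
by rewrite -mE // lexx andbT -(rtime_leE G) // mE.
Qed.

Lemma step_index_gap {R : realType} (G : seq (R * 'rV[R]_2)) (c k : nat) (t : R) :
  discrete_trajectory G -> (c < size G)%N -> (k.+1 < size G)%N ->
  rtime G k < t < rtime G k.+1 ->
  step_index G c t = if t < rtime G c then k.+1 else k.
Proof.
move=> sG hc hk /andP[kt tk]; have [hm] := step_indexP G c t sG hc.
case: ifP => _ [_ mE]; apply/eqP; rewrite eqn_leq.
  by rewrite -mE // ltW //= ltnNge -mE ?(ltnW hk) // -ltNge.
by rewrite -mE ?(ltnW hk) // ltW // andbT -ltnS ltnNge -mE // -ltNge.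
Qed.

(** * Dense stay segments, stay segments and travel segments *)

Lemma dense_stay_segment_le {R : realType} (s s' dT : R)
    (G : seq (R * 'rV[R]_2)) (p q : nat) :
  s <= s' -> dense_stay_segment s dT G p q -> dense_stay_segment s' dT G p q.
Proof.
move=> ss [hq long close gap]; split=> // i j hi hj.
by apply: lt_le_trans ss; apply: close.
Qed.

(** At each time between its ends the trajectory is within [dS / 3] of some record of the dense
    segment, and these records are within [dS / 3] of each other; three such steps give [dS]. *)
Lemma dense_in_stay_segment {R : realType} (dS dT : R)
    (G : seq (R * 'rV[R]_2)) (ell : ctraj R) (p i q : nat) :
  discrete_trajectory G -> consistent dS dT G ell ->
  dense_stay_segment (dS / 3) dT G p q -> (p <= i <= q)%N ->
  in_stay_segment dS dT ell (rtime G i).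
Proof.
move=> sG [onG stay3 _] dense hi; have [hpq long close gap] := dense.
have [hp hq] : (p < size G)%N /\ (q < size G)%N by lia.
have near t : t \in `[rtime G p, rtime G q] ->
    exists2 k, (p <= k <= q)%N & edist (ell t) (rloc G k) < dS / 3.
  rewrite in_itv /= => /andP[pt tq].
  have [hm] := step_indexP G p t sG hp.
  rewrite ltNge pt /=; set m := step_index _ _ _ => -[pm mE].
  have mt : rtime G m <= t by rewrite mE.
  have mq : (m <= q)%N by rewrite -(rtime_leE G) // (le_trans mt).
  exists m; first by rewrite pm.
  have [<-|nmt] := eqVneq (rtime G m) t.
    by rewrite (onG m hm).2 edistxx -(edistxx (rloc G m)) close //; lia.
  have mltt : rtime G m < t by rewrite lt_neqAle nmt.
  have mltq : (m < q)%N by rewrite -(rtime_ltE G) // (lt_le_trans mltt).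
  have tm : t < rtime G m.+1 by rewrite ltNge mE ?ltnn //; lia.
  rewrite -(onG m hm).2; apply: (stay3 p q dense m _ t _).1; first by lia.
  by rewrite in_itv /= mltt.
exists (rtime G p), (rtime G q); split.
  split=> //.
    split; last 2 first.
    - by rewrite rtime_leE //; lia.
    - by have [] := onG q hq; rewrite in_itv => /andP[].
    - by have [] := onG p hp; rewrite in_itv => /andP[].
  move=> t t' /near[k hk tk] /near[k' hk' tk'].
  have := edist_triangle (rloc G k) (ell t) (ell t').
  have := edist_triangle (rloc G k') (rloc G k) (ell t').
  by have := close k k' hk hk'; rewrite (edistC (rloc G k')); lra.
by rewrite in_itv /= !rtime_leE //; lia.
Qed.

(** A time outside all stay segments is by itself a travel segment, as a single point is a
    period. *)
Lemma in_travel_segmentE {R : realType} (dS dT : R) (ell : ctraj R) (t : R) :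
  t \in `[ct_lo ell, ct_hi ell] ->
  in_travel_segment dS dT ell t <-> ~ in_stay_segment dS dT ell t.
Proof.
rewrite in_itv /= => /andP[lot thi]; split.
  move=> [c [d [[_ h] htcd]]] [c' [d' [stay htc'd']]].
  by have := h _ _ stay t htcd; rewrite htc'd'.
move=> nstay; exists t, t; split; last by rewrite in_itv /= lexx.
split=> // c' d' stay x; rewrite in_itv /= => /le_anti <-.
by apply/negP => htc'd'; apply: nstay; exists c', d'.
Qed.

(** * Consistent trajectories witnessing that a mobility cannot be inferred *)

(** Holding the location of an end of the gap satisfies the stay assumption, since records of a
    dense segment are close to each other. Checking dense segments under [dS] covers those under
    [dS / 3]. *)
Lemma consistent_CTraj {R : realType} (dS dT : R) (G : seq (R * 'rV[R]_2))
    (lo hi : R) (lohi : lo <= hi) (f : R -> 'rV[R]_2) :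
  discrete_trajectory G -> 0 < dS ->
  (forall k : nat, (k < size G)%N ->
     lo <= rtime G k <= hi /\ f (rtime G k) = rloc G k) ->
  (forall p q k : nat, dense_stay_segment dS dT G p q -> (p <= k < q)%N ->
     forall t : R, rtime G k < t < rtime G k.+1 ->
     f t = rloc G k \/ f t = rloc G k.+1) ->
  consistent dS dT G (CTraj lohi f).
Proof.
move=> sG dS0 onG gaps.
have stay s : s <= dS -> continuous_stay_assumption s dT G (CTraj lohi f).
  move=> sdS p q dense k hk t; rewrite in_itv /= => ht.
  have [hpq _ close _] := dense.
  have [hk0 hk1] : (k < size G)%N /\ (k.+1 < size G)%N by lia.
  rewrite (onG k hk0).2 (onG k.+1 hk1).2.
  case: (gaps p q k (dense_stay_segment_le _ _ _ _ _ _ sdS dense) hk t ht) => ->;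
    by split; apply: close; lia.
split; [|apply: stay; lra|exact: stay].
by move=> k hk; rewrite in_itv /=; apply: onG.
Qed.

Lemma step_index_before {R : realType} (G : seq (R * 'rV[R]_2)) (c : nat) (u : R) :
  discrete_trajectory G -> (c < size G)%N -> u < rtime G c ->
  exists t : R, [/\ u <= t, t < rtime G c & step_index G c t = c].
Proof.
case: c => [|k] sG hc hu.
  exists u; split=> //; have [_] := step_indexP G 0 u sG hc.
  by rewrite hu => -[m0 _]; apply/eqP; rewrite -leqn0.
have ltk : rtime G k < rtime G k.+1 by rewrite rtime_ltE //; lia.
(* The midpoint keeps [t] inside the gap before the record even when [u] precedes that gap. *)
pose t := Num.max u ((rtime G k + rtime G k.+1) / 2).
have kt : rtime G k < t by rewrite lt_max; apply/orP; right; lra.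
have tk : t < rtime G k.+1 by rewrite gt_max hu /=; lra.
exists t; split=> //; first by rewrite le_max lexx.
by rewrite (step_index_gap G k.+1 k t) ?tk // kt.
Qed.

Lemma step_index_after {R : realType} (G : seq (R * 'rV[R]_2)) (c : nat) (u : R) :
  discrete_trajectory G -> (c < size G)%N -> rtime G c < u ->
  exists t : R, [/\ t <= u, rtime G c < t & step_index G c t = c].
Proof.
move=> sG hc hu; have [lastc|clast] := leqP (size G) c.+1.
  exists u; split=> //; have [hm] := step_indexP G c u sG hc.
  by rewrite ltNge (ltW hu) => -[cm _]; lia.
have ltc : rtime G c < rtime G c.+1 by rewrite rtime_ltE.
pose t := Num.min u ((rtime G c + rtime G c.+1) / 2).
have ct : rtime G c < t by rewrite lt_min hu /=; lra.
have tc : t < rtime G c.+1 by rewrite gt_min; apply/orP; right; lra.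
exists t; split=> //; first by rewrite ge_min lexx.
by rewrite (step_index_gap G c c t) ?ct // ltNge (ltW ct).
Qed.

Lemma inferred_stay_dense {R : realType} (dS dT : R) (G : seq (R * 'rV[R]_2))
    (i : nat) :
  discrete_trajectory G -> 0 < dS -> 0 < dT -> (i < size G)%N ->
  inferred_stay dS dT G i ->
  exists p q : nat, (p <= i <= q)%N /\ dense_stay_segment dS dT G p q.
Proof.
move=> sG dS0 dT0 hi inferred; apply: contrapT => ndense.
have [z zE] := exists_edist_eq (rloc G i) dS (ltW dS0).
(* The step index equals [i] on the gaps on both sides of record [i], so [f] takes the value [z]
   there and leaves [i] isolated. *)
pose f t := if (step_index G i t == i) && (t != rtime G i) then z
            else rloc G (step_index G i t).
have G0 : (0 < size G)%N by apply: leq_ltn_trans hi.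
have lohi : rtime G 0 <= rtime G (size G).-1 by rewrite rtime_leE // ltn_predL.
have fi : f (rtime G i) = rloc G i.
  by rewrite /f eqxx andbF step_index_rtime.
have cons : consistent dS dT G (CTraj lohi f).
  apply: consistent_CTraj => //.
    move=> k hk; split; first by rewrite !rtime_leE //; lia.
    rewrite /f step_index_rtime //; case: eqVneq => [->|//].
    by rewrite eqxx.
  move=> p q k dense hk t ht; have [hpq _ _ _] := dense.
  rewrite /f (step_index_gap G i k) //; last by lia.
  have ki : (k == i) = false.
    by apply/eqP => e; apply: ndense; exists p, q; split=> //; lia.
  have k1i : (k.+1 == i) = false.
    by apply/eqP => e; apply: ndense; exists p, q; split=> //; lia.
  by case: (t < _); rewrite ?ki ?k1i /=; [right|left].
have [c [d [[_ hcd near]]]] := inferred _ cons.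
rewrite in_itv /= => /andP[ci id].
have no t : c <= t <= d -> step_index G i t = i -> t != rtime G i -> False.
  move=> htcd ti tni; have := near (rtime G i) t.
  rewrite !in_itv /= ci id htcd => /(_ isT isT).
  by rewrite fi /f ti eqxx tni /= zE ltxx.
(* A stay segment has positive length, so it extends to at least one side of record [i], where it
   meets the value [z]. *)
have [clti|ic] := ltP c (rtime G i).
  have [t [ct ti tE]] := step_index_before G i c sG hi clti.
  by apply: (no t) => //; [rewrite ct (le_trans (ltW ti))|rewrite lt_eqF].
have [|t [td it tE]] := step_index_after G i d sG hi; first by lra.
by apply: (no t) => //; [rewrite td (le_trans ci (ltW it))|rewrite gt_eqF].
Qed.

Lemma consistent_step {R : realType} (dS dT : R) (G : seq (R * 'rV[R]_2))
    (c : nat) (lo hi : R) (lohi : lo <= hi) :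
  discrete_trajectory G -> 0 < dS -> (c < size G)%N ->
  lo <= rtime G 0 -> rtime G (size G).-1 <= hi ->
  consistent dS dT G (CTraj lohi (fun t => rloc G (step_index G c t))).
Proof.
move=> sG dS0 hc lo0 hin; have G0 : (0 < size G)%N by apply: leq_ltn_trans hc.
apply: consistent_CTraj => //.
  move=> k hk; rewrite step_index_rtime //; split=> //; apply/andP; split.
    by apply: le_trans lo0 _; rewrite rtime_leE.
  by apply: le_trans _ hin; rewrite rtime_leE //; lia.
move=> p q k [hpq _ _ _] hk t ht; rewrite (step_index_gap G c k) //; last by lia.
by case: ifP => _; [right|left].
Qed.

(** At a time of the open period the step function reads a record between that time and record [c],
    hence one within [dS / 2] of [c]; two such values are closer than [dS]. *)
Lemma exists_consistent_stay {R : realType} (dS dT : R)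
    (G : seq (R * 'rV[R]_2)) (c : nat) (lo hi : R) :
  discrete_trajectory G -> 0 < dS -> 0 < dT -> (c < size G)%N ->
  lo < rtime G c -> rtime G c < hi -> dT < hi - lo ->
  (forall k : nat, (k < size G)%N -> lo < rtime G k < hi ->
     edist (rloc G c) (rloc G k) < dS / 2) ->
  exists2 ell : ctraj R, consistent dS dT G ell
    & in_stay_segment dS dT ell (rtime G c).
Proof.
move=> sG dS0 dT0 hc loc chi lohi near.
pose f t := rloc G (step_index G c t).
have G0 : (0 < size G)%N by apply: leq_ltn_trans hc.
(* The period must contain all records and also [lo] and [hi], which may lie beyond them. *)
pose a := Num.min lo (rtime G 0); pose b := Num.max hi (rtime G (size G).-1).
have ab : a <= b by rewrite ge_min le_max; apply/orP; left; apply/orP; left; lra.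
exists (CTraj ab f).
  by apply: consistent_step; rewrite // (ge_min, le_max) lexx orbT.
(* The midpoint of the admissible starts: the window from [u] to [u + dT] must contain the time of
   [c] and lie strictly between [lo] and [hi]. The strict hypotheses make this range nonempty. *)
pose u := (Num.max lo (rtime G c - dT) + Num.min (rtime G c) (hi - dT)) / 2.
have [ulo udT uc uhi] : [/\ lo < u, rtime G c <= u + dT, u <= rtime G c & u + dT < hi].
  rewrite /u /Num.max /Num.min; split; case: ifP; case: ifP; lra.
have inear t : u <= t <= u + dT -> edist (rloc G c) (f t) < dS / 2.
  move=> /andP[ut tu]; have [hm] := step_indexP G c t sG hc.
  rewrite /f; case: ifP => htc [cm mE]; apply: near => //.
    have tm : t <= rtime G (step_index G c t) by rewrite mE.
    have mc : rtime G (step_index G c t) <= rtime G c by rewrite rtime_leE.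
    by apply/andP; split; lra.
  have mt : rtime G (step_index G c t) <= t by rewrite mE.
  have cm' : rtime G c <= rtime G (step_index G c t) by rewrite rtime_leE.
  by apply/andP; split; lra.
exists u, (u + dT); split; last by rewrite in_itv /= uc udT.
split=> /=; last 1 first.
- move=> t t'; rewrite !in_itv /= => /inear nt /inear nt'.
  have := edist_triangle (rloc G c) (f t) (f t').
  by rewrite (edistC (f t) (rloc G c)); lra.
- split=> /=; [|lra|].
  + by rewrite ge_min; apply/orP; left; apply: ltW.
  + by rewrite le_max; apply/orP; left; apply: ltW.
- lra.
Qed.

(** * The SDS labels of the whole trajectory *)

Lemma sds_stayP {R : realType} (a dT : R) (G : seq (R * 'rV[R]_2)) (i : nat) :
  discrete_trajectory G -> 0 < a -> 0 < dT -> (i < size G)%N ->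
  nth false (sds_stay a dT G) i <->
  exists p q : nat, (p <= i <= q)%N /\ dense_stay_segment a dT G p q.
Proof.
move=> sG a0 dT0 hi; have [o [B [blk hB nthE]]] := cut_blocks_nth dT G i hi.
rewrite /sds_stay (nthE (fun B j => j \in block_stay a dT B)).
exact: mem_block_stayE.
Qed.

(** A stay segment through the record would contain neither the left nor the right far record, so it
    would lie strictly between them and be shorter than [dT]. *)
Lemma sds_travel_in_travel_segment {R : realType} (a dS dT : R)
    (G : seq (R * 'rV[R]_2)) (ell : ctraj R) (i : nat) :
  discrete_trajectory G -> consistent dS dT G ell -> (i < size G)%N ->
  nth false (sds_travel a dS dT G) i ->
  in_travel_segment dS dT ell (rtime G i).
Proof.
move=> sG [onG _ _] hi; have [o [B [[szB nthB _ _ _] hB nthE]]] := cut_blocks_nth dT G i hi.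
rewrite /sds_travel (nthE (fun B => block_travel a dS dT B)) /block_travel.
case/and3P=> _ _.
have := ohead_filter_iota (far dS B (i - o)) (i - o).+1 (size B - (i - o).+1).
have := ohead_filter_rev_iota (far dS B (i - o)) 0 (i - o).
case: ohead => [l [hl farl _]|//]; case: ohead => [r [hr farr _]|//].
have farG k : (k < size B)%N -> far dS B (i - o) k ->
    dS <= edist (ell (rtime G i)) (ell (rtime G (o + k))).
  move=> hk; rewrite /far /rloc !nthB ?subnKC //; try lia.
  by rewrite (onG i hi).2 (onG (o + k)%N _).2 //; lia.
rewrite /rtime !nthB; try lia; rewrite -!/(rtime _ _) => rl.
have li : rtime G (o + l) < rtime G i by rewrite rtime_ltE //; lia.
have ir : rtime G i < rtime G (o + r) by rewrite rtime_ltE //; lia.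
apply/in_travel_segmentE; first exact: (onG i hi).1.
move=> [c [d [[_ hcd near]]]]; rewrite in_itv /= => /andP[ci id].
have out k : (k < size B)%N -> far dS B (i - o) k ->
    rtime G (o + k) < c \/ d < rtime G (o + k).
  move=> hk /(farG k hk); have [ck|] := leP c (rtime G (o + k)); last by left.
  have [kd|] := leP (rtime G (o + k)) d; last by right.
  by rewrite leNgt near // in_itv /= ?ci ?ck.
have := out l ltac:(lia) farl; have := out r ltac:(lia) farr.
by case=> h1; case=> h2; lra.
Qed.

Lemma inferred_travel_labeled {R : realType} (dS dT : R)
    (G : seq (R * 'rV[R]_2)) (i : nat) :
  discrete_trajectory G -> 0 < dS -> 0 < dT -> (i < size G)%N ->
  inferred_travel dS dT G i ->
  nth false (sds_travel (dS / 2 / 3) (dS / 2) dT G) i.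
Proof.
move=> sG dS0 dT0 hi inferred.
have nostay ell : consistent dS dT G ell -> ~ in_stay_segment dS dT ell (rtime G i).
  move=> cons; apply/in_travel_segmentE; last exact: inferred.
  by have [/(_ i hi)[]] := cons.
have [o [B [blk hB nthE]]] := cut_blocks_nth dT G i hi.
have [szB nthB gapB gapl gapr] := blk.
rewrite /sds_travel (nthE (fun B => block_travel _ _ dT B)) /block_travel.
(* Otherwise [i] lies in a dense segment under [dS / 6], hence under [dS / 3], and is in a stay
   segment of any consistent trajectory; the step function provides one. *)
have -> : (i - o)%N \notin block_stay (dS / 2 / 3) dT B.
  apply/negP; rewrite (mem_block_stayE _ _ _ _ _ _ sG _ dT0 blk) //; last by lra.
  move=> [p [q [hpq dense]]].
  have G0 : (0 < size G)%N by apply: leq_ltn_trans hi.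
  have lohi : rtime G 0 <= rtime G (size G).-1 by rewrite rtime_leE // ltn_predL.
  have cons := consistent_step dS dT G i _ _ lohi sG dS0 hi (lexx _) (lexx _).
  apply: (nostay _ cons); apply: (dense_in_stay_segment dS dT G _ p i q) => //.
  by apply: dense_stay_segment_le dense; lra.
have rtB j : (j < size B)%N -> rtime B j = rtime G (o + j).
  by move=> hj; rewrite /rtime nthB.
have nearG k : (k < size B)%N -> ~~ far (dS / 2) B (i - o) k ->
    edist (rloc G i) (rloc G (o + k)) < dS / 2.
  by move=> hk; rewrite /far -ltNge /rloc !nthB ?subnKC //; lia.
(* The bound is the first record after the block or, when the block is the last one, an arbitrary
   time more than [dT] away; [gapl0] mirrors this on the left. *)
have gapr0 : exists2 hi', rtime G i + dT < hi' & forall k, (k < size G)%N ->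
    rtime G k < hi' -> (k < o + size B)%N.
  have [oG|Go] := ltnP (o + size B) (size G).
    exists (rtime G (o + size B)); last by move=> k hk; rewrite rtime_ltE.
    have := gapr oG.
    have : rtime G i <= rtime G (o + size B).-1 by rewrite rtime_leE //; lia.
    lra.
  by exists (rtime G i + dT + 1); [lra|lia].
have gapl0 : exists2 lo, lo < rtime G i - dT & forall k, (k < size G)%N ->
    lo < rtime G k -> (o <= k)%N.
  have [o0|o0] := posnP o.
    by exists (rtime G i - dT - 1); [lra|lia].
  exists (rtime G o.-1); last by move=> k hk; rewrite rtime_ltE //; lia.
  have := gapl o0; have : rtime G o <= rtime G i by rewrite rtime_leE //; lia.
  lra.
have := ohead_filter_iota (far (dS / 2) B (i - o)) (i - o).+1 (size B - (i - o).+1).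
have := ohead_filter_rev_iota (far (dS / 2) B (i - o)) 0 (i - o).
set l := ohead _; set r := ohead _ => hl hr.
(* A missing far record is replaced by the cut at the end of the block, more
   than dT away. *)
have [hi' [ihi nearr hiE]] : exists hi', [/\ rtime G i < hi',
    forall k, (k < size G)%N -> (i < k)%N -> rtime G k < hi' ->
      edist (rloc G i) (rloc G k) < dS / 2
    & if r is Some r' then hi' = rtime B r' /\ (i - o < r' < size B)%N
      else rtime G i + dT < hi'].
  case: r hr => [r' [hr' _ near]|near].
    exists (rtime B r'); rewrite rtB; last by lia.
    split; [by rewrite rtime_ltE //; lia| |by split=> //; lia].
    move=> k hk ik; rewrite rtime_ltE //; last by lia.
    move=> kr; have -> : k = (o + (k - o))%N by lia.
    by apply: nearG; [lia|apply: near; lia].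
  have [hi' ihi hiE] := gapr0; exists hi'; split=> //; first by lra.
  move=> k hk ik /(hiE k hk) kB; have -> : k = (o + (k - o))%N by lia.
  by apply: nearG; [lia|apply: near; lia].
have [lo [loi nearl loE]] : exists lo, [/\ lo < rtime G i,
    forall k, (k < size G)%N -> (k < i)%N -> lo < rtime G k ->
      edist (rloc G i) (rloc G k) < dS / 2
    & if l is Some l' then lo = rtime B l' /\ (l' < i - o)%N
      else lo < rtime G i - dT].
  case: l hl => [l' [hl' _ near]|near].
    exists (rtime B l'); rewrite rtB; last by lia.
    split; [by rewrite rtime_ltE //; lia| |by split=> //; lia].
    move=> k hk ki; rewrite rtime_ltE //; last by lia.
    move=> lk; have -> : k = (o + (k - o))%N by lia.
    by apply: nearG; [lia|apply: near; lia].
  have [lo loi loE] := gapl0; exists lo; split=> //; first by lra.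
  move=> k hk ki /(loE k hk) ok; have -> : k = (o + (k - o))%N by lia.
  by apply: nearG; [lia|apply: near; lia].
have short : hi' - lo <= dT.
  rewrite leNgt; apply/negP => long.
  have [|ell cons stay] :=
    exists_consistent_stay dS dT G i lo hi' sG dS0 dT0 hi loi ihi long.
    move=> k hk /andP[lok khi]; case: (ltngtP k i) => [ki|ik|->].
    - exact: nearl.
    - exact: nearr.
    - by rewrite edistxx; lra.
  exact: nostay stay.
(* A missing far record would put its bound more than [dT] from record [i], against [short]. So both
   exist, and [i] is neither first nor last in its block. *)
case: l hl loE => [l' _ [loE hl']|_ loE]; last by move: (r) hiE => [r' []|]; lra.
case: r hr hiE => [r' _ [hiE hr']|_ hiE]; last by lra.
by apply/and3P; split=> //; [lia|rewrite -hiE -loE].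
Qed.

(** * Counting labels and the recall bounds *)

Lemma size_labels {R : realType} (dT : R) (G : seq (R * 'rV[R]_2))
    (f : seq (R * 'rV[R]_2) -> nat -> bool) :
  size (flatten [seq mkseq (f B) (size B) | B <- cut_blocks dT G]) = size G.
Proof.
have [GE _ _ _] := cut_blocksP dT G.
rewrite -[in RHS]GE !size_flatten; congr sumn.
by rewrite /shape -map_comp; apply: eq_map => B /=; rewrite size_mkseq.
Qed.

Lemma count_idE (s : bitseq) :
  count id s = #|[set i : 'I_(size s) | nth false s i]|.
Proof.
by rewrite -sum1_count (big_nth false) big_mkord -sum1_card; apply: eq_bigl => i; rewrite inE.
Qed.

(** Since [lab] implies [P], the numerator of the fraction is the full count of [lab]; since [P]
    implies [lab'], its denominator is at most the count of [lab']. *)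
Lemma fraction_labeled_ge (R : realType) (n : nat) (lab lab' : bitseq)
    (P : nat -> Prop) :
  size lab = n -> size lab' = n ->
  (forall i : nat, (i < n)%N -> nth false lab i -> P i) ->
  (forall i : nat, (i < n)%N -> P i -> nth false lab' i) ->
  (exists i : nat, (i < n)%N /\ P i) ->
  (0 < count id lab')%N /\
  fraction_labeled R n (nth false lab) P
    >= (count id lab)%:R / (count id lab')%:R.
Proof.
move=> szl szl' labP Plab' [i [hi Pi]].
have P0 : (0 < #|[set i : 'I_n | `[< P i >]]|)%N.
  by apply/card_gt0P; exists (Ordinal hi); rewrite inE; apply/asboolP.
have le_lab' : (#|[set i : 'I_n | `[< P i >]]| <= count id lab')%N.
  rewrite count_idE szl'; apply: subset_leq_card; apply/subsetP => j.
  by rewrite !inE => /asboolP; apply: Plab'.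
split; first by apply: leq_trans le_lab'.
rewrite /fraction_labeled.
have -> : [set i : 'I_n | `[< P i >] && nth false lab i] = [set i : 'I_n | nth false lab i].
  apply/setP => j; rewrite !inE; case labj: (nth false lab j); rewrite ?andbF //.
  by rewrite andbT; apply/asboolP/labP.
rewrite count_idE szl ler_wpM2l ?ler0n // lef_pV2 ?posrE ?ltr0n //.
  by rewrite ler_nat.
by apply: leq_trans le_lab'.
Qed.

Theorem mainTheorem2 (R : realType) (Gamma : seq (R * 'rV[R]_2)) (dS dT : R)
    (Gamma_traj : discrete_trajectory Gamma)
    (dS_gt0 : 0 < dS) (dT_gt0 : 0 < dT) :
  [/\ forall ell : ctraj R, consistent dS dT Gamma ell ->
        forall i : nat, (i < size Gamma)%N ->
          (labeled_stay dS dT Gamma i ->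
             in_stay_segment dS dT ell (rtime Gamma i)) /\
          (labeled_travel dS dT Gamma i ->
             in_travel_segment dS dT ell (rtime Gamma i)),
      (exists i : nat, (i < size Gamma)%N /\ inferred_stay dS dT Gamma i) ->
        (0 < NS dT Gamma dS)%N /\
        stay_recall dS dT Gamma >=
          (NS dT Gamma (dS / 3))%:R / (NS dT Gamma dS)%:R
    & (exists i : nat, (i < size Gamma)%N /\ inferred_travel dS dT Gamma i) ->
        (0 < NT dT Gamma (dS / 2))%N /\
        travel_recall dS dT Gamma >=
          (NT dT Gamma dS)%:R / (NT dT Gamma (dS / 2))%:R].
Proof.
have dS30 : 0 < dS / 3 by lra.
have stay_sound ell i : consistent dS dT Gamma ell -> (i < size Gamma)%N ->
    labeled_stay dS dT Gamma i -> in_stay_segment dS dT ell (rtime Gamma i).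
  move=> cons hi /sds_stayP[] // p [q [hpq dense]].
  exact: (dense_in_stay_segment dS dT Gamma ell p i q).
have travel_sound ell i : consistent dS dT Gamma ell -> (i < size Gamma)%N ->
    labeled_travel dS dT Gamma i ->
    in_travel_segment dS dT ell (rtime Gamma i).
  by move=> cons hi; apply: sds_travel_in_travel_segment.
split.
- by move=> ell cons i hi; split; [apply: stay_sound|apply: travel_sound].
- apply: fraction_labeled_ge; rewrite ?size_labels //.
    (* Precision holds for every consistent trajectory, so a labeled record is an inferred one. *)
    by move=> i hi lab ell cons; apply: stay_sound.
  move=> i hi /inferred_stay_dense h; apply/sds_stayP => //.
  exact: h.
- apply: fraction_labeled_ge; rewrite ?size_labels //.
    by move=> i hi lab ell cons; apply: travel_sound.
  by move=> i hi; apply: inferred_travel_labeled.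
Qed.
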